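(* For every $n\ge1$ the triangular ladder $TL_n$ is semi-symmetrized $e$-positive; consequently its chromatic symmetric function $X_{TL_n}$ is $e$-positive.
   Context: $TL_n$ ($=P_{n,2}$) is the graph on vertex set $[n]$ with an edge between $i,j$ exactly when $1\le|i-j|\le2$. For a simple graph $G$ on $[n]$, $Y_G=\sum_\kappa x_{\kappa(1)}\cdots x_{\kappa(n)}$ in non-commuting variables $x_1,x_2,\dots$, summed over proper colorings $\kappa:[n]\to\{1,2,\dots\}$, and $X_G$ is the same sum with commuting variables (Stanley's chromatic symmetric function). For $\pi\vdash[n]$, $e_\pi=\sum x_{i_1}\cdots x_{i_n}$ (non-commuting) over tuples with $i_j\ne i_k$ whenever $j\ne k$ are in a common block. For $\pi,\sigma\vdash[n]$, $\pi\sim\sigma$ if they have the same multiset of block sizes and the block of $\pi$ containing $n$ has the same size as that of $\sigma$ containing $n$; for homogeneous degree-$n$ $f,g$, $f\equiv_n g$ means that for each $\sim$-class the sums of $e$-coefficients of $f$ and of $g$ over the class coincide. $f$ is semi-symmetrized $e$-positive if $f\equiv_n g$ for some $g$ that is a nonnegative linear combination of the $e_\pi$; a graph $G$ on $[n]$ is semi-symmetrized $e$-positive if $Y_G$ is. A symmetric function in commuting variables is $e$-positive if it is a nonnegative linear combination of the elementary symmetric functions $e_\lambda$. *)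

(* Defs.v *)
From HB Require Import structures.
From mathcomp Require Import all_boot all_order all_algebra.
Set Implicit Arguments. Unset Strict Implicit. Unset Printing Implicit Defensive.
Import Order.TTheory GRing.Theory Num.Theory.
Local Open Scope ring_scope.

(* Vertex i of [n] is represented by the ordinal i-1 : 'I_n.
   Colours / variable indices are represented by nat (x_1,x_2,... ~ x_0,x_1,...). *)

Definition tl_adj (n : nat) : rel 'I_n :=
  fun i j => [&& i != j, (i <= j + 2)%N & (j <= i + 2)%N].

Definition proper_word (n : nat) (adj : rel 'I_n) (w : 'I_n -> nat) : bool :=
  [forall i, forall j, adj i j ==> (w i != w j)].

(** ---------- Non-commutative side (NCSym), homogeneous of degree n ----------
   A homogeneous degree-n series in non-commuting variables x_0,x_1,... is
   represented by its coefficient function on words w : 'I_n -> nat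
   (the coefficient of x_{w 0} x_{w 1} ... x_{w (n-1)}). *)
Definition ncseries (n : nat) := ('I_n -> nat) -> rat.

Definition YG (n : nat) (adj : rel 'I_n) : ncseries n :=
  fun w => (proper_word adj w)%:R.

Definition setpart (n : nat) (P : {set {set 'I_n}}) : bool := partition P [set: 'I_n].

Definition eNC (n : nat) (P : {set {set 'I_n}}) : ncseries n :=
  fun w => ([forall B in P, forall i in B, forall j in B, (i != j) ==> (w i != w j)] : bool)%:R.

Definition ecoeffs (n : nat) (f : ncseries n) (c : {set {set 'I_n}} -> rat) : Prop :=
  forall w : 'I_n -> nat, f w = \sum_(P : {set {set 'I_n}} | setpart P) c P * eNC P w.

Definition block_sizes (n : nat) (P : {set {set 'I_n}}) : seq nat :=
  [seq #|B| | B : {set 'I_n} <- enum P].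

Definition last_block_size (n : nat) (P : {set {set 'I_n}}) : nat :=
  if [pick x : 'I_n | val x == n.-1] is Some x then #|pblock P x| else 0.

Definition psim (n : nat) (P Q : {set {set 'I_n}}) : bool :=
  perm_eq (block_sizes P) (block_sizes Q) && (last_block_size P == last_block_size Q).

Definition semi_equiv (n : nat) (f g : ncseries n) : Prop :=
  exists (c d : {set {set 'I_n}} -> rat),
    [/\ ecoeffs f c, ecoeffs g d &
      forall P, setpart P ->
        \sum_(Q : {set {set 'I_n}} | setpart Q && psim P Q) c Q =
        \sum_(Q : {set {set 'I_n}} | setpart Q && psim P Q) d Q].

Definition e_nonneg_comb (n : nat) (g : ncseries n) : Prop :=
  exists d : {set {set 'I_n}} -> rat, (forall P, 0 <= d P) /\ ecoeffs g d.

Definition semi_sym_e_positive (n : nat) (f : ncseries n) : Prop :=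
  exists g : ncseries n, semi_equiv f g /\ e_nonneg_comb g.

(** ---------- Commutative side (symmetric functions) ----------
   A series in commuting variables x_0,x_1,... is represented by its
   coefficients on monomials x^alpha, where alpha : 'I_m -> nat is an exponent
   vector in the first m variables (every monomial lives in some finitely many
   variables; m ranges over all nat). *)
Definition cseries := forall m : nat, ('I_m -> nat) -> rat.

Definition XG (n : nat) (adj : rel 'I_n) : cseries :=
  fun m alpha =>
    #|[set k : {ffun 'I_n -> 'I_m} |
        proper_word adj (fun i => val (k i)) &&
        [forall j, #|[set i | k i == j]| == alpha j]]|%:R.

(** e_lambda = e_{lambda_1} ... e_{lambda_l}, with e_k = sum_{|S| = k} x^S;
    coefficient of x^alpha = number of tuples (S_1,...,S_l) of sets of
    variables with |S_i| = lambda_i and each variable j lying in exactly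
    alpha_j of them. *)
Definition eSym (lam : seq nat) : cseries :=
  fun m alpha =>
    #|[set S : {ffun 'I_(size lam) -> {set 'I_m}} |
        [forall i, #|S i| == nth 0%N lam i] &&
        [forall j, #|[set i | j \in S i]| == alpha j]]|%:R.

Definition is_intpart (n : nat) (lam : seq nat) : bool :=
  [&& sorted geq lam, all (fun k => 0 < k)%N lam & sumn lam == n].

Definition e_positive (n : nat) (F : cseries) : Prop :=
  exists s : seq (seq nat * rat),
    all (fun p => is_intpart n p.1 && (0 <= p.2)) s /\
    forall m (alpha : 'I_m -> nat),
      F m alpha = \sum_(p <- s) p.2 * eSym p.1 alpha.

Arguments tl_adj n : clear implicits.

(* Main.v *)
(* Tracking the colour of the last vertex turns [Y_G] into a rooted chromatic
   series, a combination of the products [e_lam * A_j], where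
   [A_j = e_j (x minus the root colour)] records a root block of size [j+1].
   With [f (u, z)] the series of the ladder in the colours of its last two
   vertices, adding a vertex is the linear map
   [f |-> sum_(u != z) x_u f (u, z) - x_v f (v, z)].  From [A_i (u) A_j (z)]
   it produces [(i-1) e_(i+1) A_j (u) + A_j (u) A_(i+1) (z)] plus the term
   [A_(i+1) A_j] in the single colour [u].  Iterating along the pairs
   [(i, j), (j, i+1), (i+1, j+1), ...], the symmetry of the last term and the
   exchange rule [A_(i+1) A_j + e_(j+1) A_i = A_i A_(j+1) + e_(i+1) A_j] give a
   subtraction-free recursion for the series started at [A_j (u)] with [j > 0];
   those of the ladder are nonnegative combinations of these.

   This positivity holds for weights in any commutative ring.  Polynomial
   weights give the identity in non-commuting variables averaged over the
   permutations fixing the last vertex, and the average only moves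
   coefficients inside a class as soon as [Y_G] is some combination of the
   [e_pi].  Such a combination exists because [e_pi] is the signed sum, over the
   Young subgroup of [pi], of the power sums of the cycle partitions, and this
   is triangular for refinement. *)

Require Import Defs.
From HB Require Import structures.
From mathcomp Require Import all_boot all_order all_algebra.
From mathcomp Require Import all_fingroup.
From mathcomp Require Import ring zify.
From mathcomp.multinomials Require Import mpoly.

Set Implicit Arguments.
Unset Strict Implicit.
Unset Printing Implicit Defensive.

Import Order.TTheory GRing.Theory Num.Theory.
Local Open Scope ring_scope.

(** * Rooted elementary symmetric functions and the transfer map of the ladder *)

Section RootedSymmetricFunctions.

Variables (R : comNzRingType) (C : finType) (x : C -> R).

Definition elemsym (V : {set C}) (j : nat) : R :=
  \sum_(S : {set C} | (#|S| == j) && [disjoint S & V]) \prod_(c in S) x c.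

Definition erooted (j : nat) (k : C) : R := elemsym [set k] j.

Lemma elemsym0 V : elemsym V 0 = 1.
Proof.
rewrite /elemsym (big_pred1 set0) ?big_set0 // => S /=.
rewrite cards_eq0; case: eqP => [->|] //=.
by rewrite disjoints_subset sub0set.
Qed.

Lemma mul_elemsymU1 (V : {set C}) c j : c \notin V ->
  x c * elemsym (c |: V) j =
  \sum_(S : {set C} | [&& #|S| == j.+1, [disjoint S & V] & c \in S])
     \prod_(d in S) x d.
Proof.
move=> cV; rewrite /elemsym big_distrr /=.
rewrite [RHS](reindex_onto (fun S => c |: S) (fun S => S :\ c)) /=; last first.
  by move=> S /and3P[_ _ cS]; rewrite setD1K.
apply: eq_big => [S|S].
  rewrite setU11 andbT; case: (boolP (c \in S)) => cS.
    have -> : [disjoint S & c |: V] = false.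
      by apply/negbTE/pred0Pn; exists c; rewrite /= cS setU11.
    rewrite andbF; apply/esym/negbTE; rewrite negb_and; apply/orP; right.
    by apply/eqP => E; move: cS; rewrite -E !inE eqxx.
  rewrite setU1K // eqxx andbT cardsU1 cS add1n eqSS; congr (_ && _).
  rewrite !disjoints_subset setCU subsetI subUset sub1set inE cV /=.
  by rewrite subsetC sub1set inE cS.
case/andP=> _ dS; rewrite big_setU1 //=.
by apply/negP => cS; move/pred0P/(_ c): dS; rewrite /= cS setU11.
Qed.

Lemma elemsymS (V : {set C}) c j : c \notin V ->
  elemsym V j.+1 = elemsym (c |: V) j.+1 + x c * elemsym (c |: V) j.
Proof.
move=> cV; rewrite mul_elemsymU1 // [LHS](bigID (fun S : {set C} => c \in S)) /=.
rewrite addrC; congr (_ + _); apply: eq_bigl => S; last by rewrite andbA.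
rewrite -andbA; congr (_ && _).
rewrite !disjoints_subset setCU subsetI andbC; congr (_ && _).
by rewrite subsetC sub1set inE.
Qed.

Lemma sum_elemsym (V : {set C}) j :
  \sum_(c | c \notin V) x c * elemsym (c |: V) j = j.+1%:R * elemsym V j.+1.
Proof.
rewrite (eq_bigr _ (fun c cV => mul_elemsymU1 j cV)).
rewrite (exchange_big_dep (fun S : {set C} => (#|S| == j.+1) && [disjoint S & V]))
  /=; last by move=> c S _ /and3P[-> ->].
rewrite /elemsym big_distrr /=; apply: eq_bigr => S /andP[/eqP cS dS].
rewrite (eq_bigl (fun c => c \in S)); last first.
  move=> c; rewrite cS eqxx dS /=; case cinS: (c \in S); rewrite ?andbF // andbT.
  by apply/negP => cV; move/pred0P/(_ c): dS; rewrite /= cinS cV.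
by rewrite sumr_const cS mulr_natl.
Qed.

Local Notation e := (elemsym set0).
Local Notation A := erooted.

Lemma erooted0 k : A 0 k = 1. Proof. exact: elemsym0. Qed.

Lemma mul_erooted j k : x k * A j k = e j.+1 - A j.+1 k.
Proof.
have /(elemsymS j) -> : k \notin set0 by rewrite in_set0.
by rewrite /erooted setU0 addrAC subrr add0r.
Qed.

Lemma sum_erooted j : \sum_k x k * A j k = j.+1%:R * e j.+1.
Proof.
rewrite -(sum_elemsym set0); apply: eq_big => [k|k _]; first by rewrite in_set0.
by rewrite setU0.
Qed.

Lemma sumD1_erooted j z :
  \sum_(u | u != z) x u * A j u = j%:R * e j.+1 + A j.+1 z.
Proof.
have := sum_erooted j; rewrite (bigD1 z) //= mul_erooted => E.
rewrite -[LHS](addKr (e j.+1 - A j.+1 z)) E; ring.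
Qed.

(* [f u z] is a series in the colours [u], [z] of the last two vertices, only
   meaningful for [u != z]; [collapse] sums over [u], while [extend] adds a
   vertex of colour [v] adjacent to both. *)
Definition collapse (f : C -> C -> R) (z : C) : R :=
  \sum_(u | u != z) x u * f u z.

Definition extend (f : C -> C -> R) (z v : C) : R := collapse f z - x v * f v z.

Definition grow k f := collapse (iter k extend f).

Lemma eq_collapse f g : (forall u z, u != z -> f u z = g u z) ->
  collapse f =1 collapse g.
Proof. by move=> fg z; apply: eq_bigr => u uz; rewrite fg. Qed.

Lemma eq_extend f g : (forall u z, u != z -> f u z = g u z) ->
  forall z v, z != v -> extend f z v = extend g z v.
Proof. by move=> fg z v zv; rewrite /extend (eq_collapse fg) fg // eq_sym. Qed.

Lemma eq_grow k f g : (forall u z, u != z -> f u z = g u z) ->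
  grow k f =1 grow k g.
Proof.
move=> fg; apply: eq_collapse; elim: k => //= k IHk.
exact: eq_extend.
Qed.

Lemma growS k f : grow k.+1 f = grow k (extend f).
Proof. by rewrite /grow iterSr. Qed.

Lemma grow_linear k a f g z :
  grow k (fun u v => a * f u v + g u v) z = a * grow k f z + grow k g z.
Proof.
have collapse_linear a' f' g' z' :
    collapse (fun u v => a' * f' u v + g' u v) z' =
    a' * collapse f' z' + collapse g' z'.
  rewrite /collapse big_distrr -big_split /=; apply: eq_bigr => u _; ring.
elim: k f g z => [|k IHk] f g z; first exact: collapse_linear.
rewrite !growS -IHk; apply: eq_grow => u v _.
rewrite /extend collapse_linear; ring.
Qed.

(* The case [k = 0] of the next three definitions is the value forced by
   extending their recursions downwards. *)
Definition gpair k i j z :=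
  if k is k'.+1 then grow k' (fun u v => A i u * A j v) z else e j * A i z.
Definition gprod k i j z :=
  if k is k'.+1 then grow k' (fun u _ => A i u * A j u) z else A i z * A j z.
Definition gclique k j z :=
  if k is k'.+1 then grow k' (fun u v => elemsym [set u; v] j) z else A j z.
Local Notation r k j := (gpair k j 0).

Lemma gprodC k i j z : gprod k i j z = gprod k j i z.
Proof.
by case: k => [|k] /=; [rewrite mulrC | apply: eq_grow => u v _; rewrite mulrC].
Qed.

Lemma gprod0 k i z : gprod k i 0 z = r k i z.
Proof.
case: k => [|k] /=; first by rewrite erooted0 elemsym0 mulrC.
by apply: eq_grow => u v _; rewrite !erooted0.
Qed.

(** Collapsing [A i u * A j v] over [u] gives [(i * e_(i+1) + A_(i+1) (v)) * A_j (v)]. The part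
    subtracted by [extend] is [(e_(i+1) - A_(i+1)) * A_j], with [A_(i+1)] at the new vertex: this
    lowers the coefficient to [i - 1], and since [A_j] now sits at the older vertex the pair becomes
    [(j, i+1)]. *)
Lemma gpairSS k i j z :
  gpair k.+1 i j z = (i%:R - 1) * e i.+1 * r k j z + gpair k j i.+1 z
                     + gprod k i.+1 j z.
Proof.
have collapseD u : collapse (fun u v => A i u * A j v) u =
    (i%:R * e i.+1 + A i.+1 u) * A j u.
  by rewrite -sumD1_erooted big_distrl; apply: eq_bigr => v _; rewrite mulrA.
case: k => [|k] /=.
  by rewrite /grow /= collapseD elemsym0; ring.
rewrite growS -grow_linear -[X in _ = X + _]mul1r -grow_linear.
by apply: eq_grow => u v _; rewrite /extend collapseD erooted0 mulrA mul_erooted; ring.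
Qed.

(** Substituting [A_(l+1) = e_(l+1) - x_u * A_l] turns both sides of [mulA] into
    [e_(i+1) A_j + e_(j+1) A_i - x_u A_i A_j], which is symmetric in [i] and [j]. *)
Lemma gprodS k i j z :
  gprod k i.+1 j z + e j.+1 * r k i z = gprod k i j.+1 z + e i.+1 * r k j z.
Proof.
have mulA u : A i.+1 u * A j u + e j.+1 * A i u = A i u * A j.+1 u + e i.+1 * A j u.
  have -> l : A l.+1 u = e l.+1 - x u * A l u by rewrite mul_erooted subKr.
  have -> : A j.+1 u = e j.+1 - x u * A j u by rewrite mul_erooted subKr.
  ring.
case: k => [|k] /=; first by rewrite elemsym0 !mul1r mulA.
rewrite addrC -grow_linear addrC -grow_linear.
by apply: eq_grow => u v _; rewrite !erooted0 !mulr1 addrC mulA addrC.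
Qed.

(** For [k > 0], [gclique] is, up to the factor [j!], the series of a ladder glued along an edge to
    a complete graph on [j + 2] vertices. It serves the start at index 0, where the coefficient
    [i - 1] of [gpairSS] would be [-1]. *)
Lemma gcliqueS k j z : gclique k.+1 j z = j%:R * r k j.+1 z + gclique k j.+1 z.
Proof.
have collapseS u : collapse (fun u v => elemsym [set u; v] j) u = j.+1%:R * A j.+1 u.
  rewrite -sum_elemsym; apply: eq_bigl => v; by rewrite in_set1.
case: k => [|k] /=; first by rewrite /grow /= collapseS elemsym0; ring.
rewrite growS -grow_linear; apply: eq_grow => u v uv.
rewrite /extend collapseS erooted0 mulr1 setUC.
have /(elemsymS j) : v \notin [set u] by rewrite in_set1 eq_sym.
by rewrite -/(erooted j.+1 u) [v |: _]setUC => ->; ring.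
Qed.

Lemma gpair00 k z : r k 0 z = gclique k 0 z.
Proof.
case: k => [|k] /=; first by rewrite elemsym0 mul1r.
by apply: eq_grow => u v _; rewrite !erooted0 elemsym0 mulr1.
Qed.

(* The chains of pairs (i, j), (j, i+1), (i+1, j+1), ... alternate between two
   parities; [chain p q] follows the terms closing the block [i], with
   coefficients [i - p] and [i - q] at the two parities. *)
Fixpoint chain (p q : R) k i j z : R :=
  if k is k'.+1 then (i%:R - p) * e i.+1 * r k' j z + chain q p k' j i.+1 z
  else e j * A i z.

(** Expanding both [gpair] terms by [gpairSS], the two [gprod] terms cancel: through [gprodS] in the
    first identity, leaving multiples of [e], and by symmetry alone in the second. The first
    identity at [k.+1] and [(i, j)] then reduces to the second at [k] and [(i, j)], and the second
    to the first at [k] and [(i+1, j+1)]; hence the joint induction. *)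
Lemma gpair_chain k i j z :
  gpair k j i z - chain 0 1 k j i z =
  gpair k i j z - chain 1 0 k i j z *+ 2 + chain 2 (-1) k i j z /\
  gpair k i j.+1 z - chain 1 0 k i j.+1 z =
  gpair k j i.+1 z - chain 0 1 k j i.+1 z *+ 2 + chain (-1) 2 k j i.+1 z.
Proof.
elim: k i j => [|k IHk] i j; first by split => /=; ring.
have [_ /(canRL (subrK _)) IH2] := IHk i j.
have [/(canRL (subrK _)) IH1 _] := IHk i.+1 j.+1.
have /(canRL (addrK _)) GS := gprodS k i j z.
split; rewrite !gpairSS /= ?(gprodC k j.+1) ?IH2 ?IH1 ?GS; ring.
Qed.

End RootedSymmetricFunctions.

(** * Positivity of the rooted series *)

Definition rooted_family :=
  forall (R : comNzRingType) (C : finType) (x : C -> R), C -> R.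

Definition rooted_term (p : seq nat * nat) : rooted_family :=
  fun R C x k => (\prod_(l <- p.1) elemsym x set0 l) * erooted x p.2 k.

(* In a pair [(lam, j)] the root lies in a block of size [j.+1]. *)
Definition rooted_type (N : nat) (p : seq nat * nat) : bool :=
  all (leq 1) p.1 && (sumn p.1 + p.2.+1 == N).

(** Coefficients are natural numbers, encoded as multiplicities in [s]. The list is chosen before
    the ring, the colours and the weights, so a single expansion serves all of them. *)
Definition rooted_e_positive (N : nat) (F : rooted_family) : Prop :=
  exists s : seq (seq nat * nat), all (rooted_type N) s /\
    forall (R : comNzRingType) (C : finType) (x : C -> R) k, F R C x k = \sum_(p <- s) rooted_term p x k.

Lemma rooted_e_positive0 N (F : rooted_family) :
  (forall (R : comNzRingType) (C : finType) (x : C -> R) k, F R C x k = 0) -> rooted_e_positive N F.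
Proof. by move=> F0; exists [::]; split=> // R C x k; rewrite F0 big_nil. Qed.

Lemma rooted_e_positiveD N (F F1 F2 : rooted_family) :
  (forall (R : comNzRingType) (C : finType) (x : C -> R) k, F R C x k = F1 R C x k + F2 R C x k) ->
  rooted_e_positive N F1 -> rooted_e_positive N F2 -> rooted_e_positive N F.
Proof.
move=> FE [s1 [s1N s1E]] [s2 [s2N s2E]]; exists (s1 ++ s2).
by rewrite all_cat s1N s2N; split=> // R C x k; rewrite FE s1E s2E big_cat.
Qed.

Lemma rooted_e_positiveMn N (F F1 : rooted_family) m :
  (forall (R : comNzRingType) (C : finType) (x : C -> R) k, F R C x k = m%:R * F1 R C x k) ->
  rooted_e_positive N F1 -> rooted_e_positive N F.
Proof.
elim: m F => [|m IHm] F FE F1pos.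
  by apply: rooted_e_positive0 => R C x k; rewrite FE mul0r.
apply: (@rooted_e_positiveD _ _ F1 (fun R C x k => m%:R * F1 R C x k)) => //.
  by move=> R C x k; rewrite FE mulrSr mulrDl mul1r addrC.
exact: IHm.
Qed.

Lemma rooted_e_positiveMe N l (F F1 : rooted_family) :
  (forall (R : comNzRingType) (C : finType) (x : C -> R) k, F R C x k = elemsym x set0 l * F1 R C x k) ->
  rooted_e_positive N F1 -> rooted_e_positive (l + N) F.
Proof.
case: l => [|l] FE [s [sN sE]].
  (* The factor [e_0 = 1] is dropped, since [rooted_type] admits only positive parts. *)
  by exists s; split=> // R C x k; rewrite FE elemsym0 mul1r sE.
exists [seq (l.+1 :: p.1, p.2) | p <- s]; split=> [|R C x k].
  rewrite all_map; apply: sub_all sN => p /andP[p1 /eqP <-].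
  by rewrite /= /rooted_type /= p1 addnA eqxx.
rewrite FE sE big_distrr big_map; apply: eq_bigr => p _.
by rewrite /rooted_term /= big_cons mulrA.
Qed.

Lemma rooted_e_positive_erooted N j : j.+1 = N ->
  rooted_e_positive N (fun R C x => erooted x j).
Proof.
move=> jN; exists [:: ([::], j)]; rewrite /= /rooted_type /= jN eqxx.
by split=> // R C x k; rewrite big_seq1 /rooted_term big_nil mul1r.
Qed.

Section Positivity.

Variable N : nat.
Hypothesis IHN : forall k j, (k + j.+1 < N)%N ->
  rooted_e_positive (k + j.+1) (fun R C x => gpair x k j 0).

Let e_gpair_positive c i k j (F : rooted_family) : (i.+1 + k + j.+1 = N)%N ->
  (forall (R : comNzRingType) (C : finType) (x : C -> R) z,
     F R C x z = c%:R * elemsym x set0 i.+1 * gpair x k j 0 z) ->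
  rooted_e_positive N F.
Proof.
move=> sN FE.
pose F1 : rooted_family := fun R C x z => elemsym x set0 i.+1 * gpair x k j 0 z.
apply: (@rooted_e_positiveMn N F F1 c).
  by move=> R C x z; rewrite FE /F1 mulrA.
have -> : (N = i.+1 + (k + j.+1))%N by lia.
by apply: (@rooted_e_positiveMe _ _ F1 (fun R C x => gpair x k j 0)) => //; apply: IHN; lia.
Qed.

(** The coefficients met along the chain are [d1], [d2], [d1 + 1], [d2 + 1], and so on; the
    witnesses [d1] and [d2] express [p <= i] and [q <= j] in rings without an order. Each cofactor
    of an [e] has smaller total size and falls under [IHN]. *)
Lemma chain_positive (d1 d2 : nat) (p q : forall R : comNzRingType, R) k i j :
  (forall R : comNzRingType, p R + d1%:R = i%:R) ->
  (forall R : comNzRingType, q R + d2%:R = j%:R) ->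
  (i + j + k.+1 = N)%N ->
  rooted_e_positive N (fun R C x z => chain x (p R) (q R) k i j z).
Proof.
elim: k d1 d2 p q i j => [|k IHk] d1 d2 p q i j pE qE sN /=.
  have -> : (N = j + i.+1)%N by lia.
  exact: (rooted_e_positiveMe _ (rooted_e_positive_erooted erefl)).
apply: rooted_e_positiveD => [R C x z||].
- reflexivity.
- apply: (@e_gpair_positive d1 i k j); first by lia.
  by move=> R C x z; rewrite -pE [p R + _]addrC addrK.
- apply: (IHk d2 d1.+1 q p) => [R|R|].
  + exact: qE.
  + by rewrite -addn1 natrD addrA pE -natrD addn1.
  + lia.
Qed.

(** The induction runs on the difference [D k j] of [gpair k j 0] and [chain 1 0 k j 0]. At second
    index 0 the product term of [gpairSS] is itself a [gpair], and [gpair_chain] yields [D (k+1) j =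
    2 * D k (j+1) + chain 2 (-1) k (j+1) 0]. The condition [0 < j] keeps the leading coefficients
    [j - 1] and [(j + 1) - 2] nonnegative. *)
Lemma gpair_positive_gt0 k j : (0 < j)%N -> (k + j.+1 = N)%N ->
  rooted_e_positive N (fun R C x => gpair x k j 0).
Proof.
move=> j_gt0 sN.
apply: (@rooted_e_positiveD _ _ (fun R C x z => chain x 1 0 k j 0 z)
  (fun R C x z => gpair x k j 0 z - chain x 1 0 k j 0 z)).
- by move=> R C x z; rewrite subrKC.
- apply: (@chain_positive j.-1 0 (fun=> 1) (fun=> 0)) => [R|R|]; last by lia.
    by rewrite nat1r prednK.
  exact: addr0.
elim: k j j_gt0 sN => [|k IHk] j j_gt0 sN.
  by apply: rooted_e_positive0 => R C x k /=; rewrite subrr.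
apply: (@rooted_e_positiveD _ _
  (fun R C x z => 2%:R * (gpair x k j.+1 0 z - chain x 1 0 k j.+1 0 z))
  (fun R C x z => chain x 2 (-1) k j.+1 0 z)).
- move=> R C x z; have [E _] := gpair_chain x k j.+1 0 z.
  rewrite gpairSS [chain x 1 0 k.+1 j 0 z]/=.
  rewrite gprod0 (canRL (subrK _) E); ring.
- apply: rooted_e_positiveMn => [R C x z|]; first reflexivity.
  by apply: IHk; lia.
apply: (@chain_positive j.-1 1 (fun=> 2) (fun=> -1)) => [R|R|]; last by lia.
  by rewrite -natrD; congr _%:R; lia.
by rewrite addrC subrr.
Qed.

(** The recursion brings in [gpair] at full size [N], beyond the reach of [IHN], but only at a
    positive index, where [gpair_positive_gt0] applies. *)
Lemma gclique_positive k j : (k + j.+1 = N)%N ->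
  rooted_e_positive N (fun R C x => gclique x k j).
Proof.
elim: k j => [|k IHk] j sN; first exact: rooted_e_positive_erooted.
apply: (@rooted_e_positiveD _ _ (fun R C x z => j%:R * gpair x k j.+1 0 z)
  (fun R C x => gclique x k j.+1)).
- by move=> R C x z; rewrite gcliqueS.
- apply: rooted_e_positiveMn => [R C x z|]; first reflexivity.
  by apply: gpair_positive_gt0 => //; lia.
- by apply: IHk; lia.
Qed.

End Positivity.

Theorem gpair_positive k j :
  rooted_e_positive (k + j.+1) (fun R C x => gpair x k j 0).
Proof.
have [N sN] : exists N, (k + j.+1 = N)%N by exists (k + j.+1)%N.
elim/ltn_ind: N k j sN => N IHN k j sN; rewrite sN.
have IH k' j' : (k' + j'.+1 < N)%N ->
    rooted_e_positive (k' + j'.+1) (fun R C x => gpair x k' j' 0).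
  by move=> lt_N; exact: IHN lt_N _ _ erefl.
case: j sN => [|j] sN; last exact: gpair_positive_gt0.
have [s [sN' sE]] := gclique_positive IH sN.
by exists s; split=> // R C x z; rewrite gpair00 sE.
Qed.

(** * Words, and the ladder as a sum over words *)

(* Words are read from the last vertex down to the first one, so that the root
   is the head and adding a vertex is [cons]. *)
Definition word n T (w : 'I_n -> T) : seq T := [seq w (rev_ord i) | i <- enum 'I_n].

Lemma size_word n T (w : 'I_n -> T) : size (word w) = n.
Proof. by rewrite size_map size_enum_ord. Qed.

Lemma word_map n T T' (f : T -> T') (w : 'I_n -> T) :
  word (fun i => f (w i)) = map f (word w).
Proof. by rewrite /word -map_comp. Qed.

Lemma nth_word n T (x0 : T) (w : 'I_n -> T) (i : 'I_n) :
  nth x0 (word w) i = w (rev_ord i).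
Proof. by rewrite (nth_map i) ?size_enum_ord // nth_ord_enum. Qed.

Lemma word_nth n T (x0 : T) s : size s = n ->
  word (fun i : 'I_n => nth x0 s (rev_ord i)) = s.
Proof.
move=> sn; apply: (@eq_from_nth _ x0) => [|i]; rewrite size_word // => lt_in.
by rewrite (nth_word _ _ (Ordinal lt_in)) rev_ordK.
Qed.

Fixpoint ladder_word (T : eqType) (s : seq T) : bool :=
  if s is c :: s' then (c \notin take 2 s') && ladder_word s' else true.

Lemma ladder_word_map (T T' : eqType) (f : T -> T') s :
  injective f -> ladder_word (map f s) = ladder_word s.
Proof.
move=> f_inj; elim: s => //= c s ->.
by rewrite -map_take mem_map.
Qed.

Lemma ladder_wordP (T : eqType) (x0 : T) s :
  reflect (forall p q, (p < q < size s)%N -> (q <= p + 2)%N ->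
             nth x0 s p != nth x0 s q)
    (ladder_word s).
Proof.
elim: s => [|c s IHs] /=; first by apply: ReflectT => p q; rewrite ltn0 andbF.
apply: (iffP andP) => [[cs /IHs ls] [|p] [|q] //=| ls].
- rewrite ltnS => ltq leq2; apply: contraNneq cs => ->.
  have lt2 : (q < 2)%N by lia.
  by rewrite -(nth_take x0 lt2) mem_nth // size_take; case: ifP => // _; lia.
- by move=> pq le2; apply: ls; lia.
split.
  apply/negP => /(nthP x0)[q]; rewrite size_take => ltq.
  have lt2 : (q < 2)%N by move: ltq; case: ifP; lia.
  rewrite nth_take // => qc; have := ls 0 q.+1; rewrite /= qc eqxx => H.
  by have/H : (0 < q.+1 < (size s).+1)%N; [move: ltq; case: ifP; lia | move=> /(_ lt2)].
by apply/IHs => p q pq le2; apply: (ls p.+1 q.+1); lia.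
Qed.

Lemma proper_ladder_word n (w : 'I_n -> nat) :
  proper_word (tl_adj n) w = ladder_word (word w).
Proof.
apply/idP/idP => [/forallP w_proper | /(ladder_wordP 0%N) lw].
  apply/(ladder_wordP 0%N) => p q /andP[ltpq]; rewrite size_word => ltq le2.
  have ltp := ltn_trans ltpq ltq.
  rewrite (nth_word _ _ (Ordinal ltp)) (nth_word _ _ (Ordinal ltq)).
  have /forallP/(_ (rev_ord (Ordinal ltq)))/implyP := w_proper (rev_ord (Ordinal ltp)).
  apply; rewrite /tl_adj (inj_eq rev_ord_inj) -val_eqE /=.
  by apply/and3P; split; [rewrite neq_ltn ltpq | lia | lia].
apply/forallP => i; apply/forallP => j; apply/implyP => /and3P[ij le1 le2].
have [-> ->] : i = rev_ord (rev_ord i) /\ j = rev_ord (rev_ord j) by rewrite !rev_ordK.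
rewrite -!(nth_word 0%N w).
have vij : i != j :> nat by [].
have := ltn_ord i; have := ltn_ord j => ltj lti.
case: (ltngtP i j) vij => // lt_ij _.
  by rewrite eq_sym; apply: lw; rewrite ?size_word /=; lia.
by apply: lw; rewrite ?size_word /=; lia.
Qed.

Section WordSums.

Variables (R : comNzRingType) (C : finType).

Fixpoint wsum n (F : seq C -> R) : R :=
  if n is n'.+1 then \sum_c wsum n' (fun s => F (c :: s)) else F [::].

Lemma eq_wsum n F F' : (forall s, size s = n -> F s = F' s) -> wsum n F = wsum n F'.
Proof.
elim: n F F' => [|n IHn] F F' FF' /=; first exact: FF'.
by apply: eq_bigr => c _; apply: IHn => s sn; apply: FF'; rewrite /= sn.
Qed.

Lemma wsumZ n a F : wsum n (fun s => a * F s) = a * wsum n F.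
Proof.
elim: n F => //= n IHn F; rewrite big_distrr; apply: eq_bigr => c _.
exact: IHn.
Qed.

Lemma wsum_cat m n F :
  wsum (m + n) F = wsum m (fun s1 => wsum n (fun s2 => F (s1 ++ s2))).
Proof. by elim: m F => //= m IHm F; apply: eq_bigr => c _; rewrite IHm. Qed.

Lemma wsum_tuple n (F : seq C -> R) : \sum_(t : n.-tuple C) F t = wsum n F.
Proof.
elim: n F => [|n IHn] F /=.
  by rewrite (big_pred1 [tuple]) // => t; rewrite (tuple0 t) /= eqxx.
transitivity (\sum_c \sum_(t : n.-tuple C) F (c :: t)); last first.
  by apply: eq_bigr => c _; apply: (IHn (fun s => F (c :: s))).
rewrite pair_bigA /=.
rewrite (reindex (fun p : C * n.-tuple C => [tuple of p.1 :: p.2])) //=.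
exists (fun t : n.+1.-tuple C => (thead t, [tuple of behead t])) => [[c t] _|t _] /=.
  by congr (_, _); apply: val_inj.
by rewrite -tuple_eta.
Qed.

Lemma wsum_ffun n (F : seq C -> R) : \sum_(w : {ffun 'I_n -> C}) F (word w) = wsum n F.
Proof.
rewrite -wsum_tuple.
pose w_of (t : n.-tuple C) := [ffun i : 'I_n => tnth t (rev_ord i)].
have wK (t : n.-tuple C) : word (w_of t) = t.
  rewrite -[RHS]map_tnth_enum; apply: eq_map => i.
  by rewrite ffunE rev_ordK.
rewrite (reindex w_of) /=; first by apply: eq_bigr => t _; rewrite wK.
exists (fun w : {ffun 'I_n -> C} => Tuple (introT eqP (size_word w))) => [t _|w _].
  by apply: val_inj; rewrite /= wK.
apply/ffunP => i; rewrite ffunE (tnth_nth (w i)).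
by rewrite [LHS]nth_word rev_ordK.
Qed.

Variable x : C -> R.

Definition wweight (s : seq C) : R := \prod_(c <- s) x c.

Lemma wweight_cat s1 s2 : wweight (s1 ++ s2) = wweight s1 * wweight s2.
Proof. exact: big_cat. Qed.

Lemma wweight_cons c s : wweight (c :: s) = x c * wweight s.
Proof. exact: big_cons. Qed.

Let ladder2 n a b := wsum n (fun s => (ladder_word [:: a, b & s])%:R * wweight s).

Let ladder2_diag n a : ladder2 n a a = 0.
Proof.
rewrite /ladder2 -(mul0r (wsum n wweight)) -wsumZ; apply: eq_wsum => s _ /=.
by rewrite inE eqxx.
Qed.

Let ladder2_extend n a b : b != a ->
  ladder2 n a b = iter n (extend x) (fun _ _ => 1) b a.
Proof.
elim: n a b => [|n IHn] a b ba.
  by rewrite /ladder2 /= inE eq_sym ba /wweight big_nil mulr1.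
rewrite /= /extend -IHn 1?eq_sym //.
have -> : ladder2 n.+1 a b = \sum_(c | c != a) x c * ladder2 n b c.
  rewrite /ladder2 /= [RHS]big_mkcond /=; apply: eq_bigr => c _.
  rewrite -wsumZ; case: ifPn => ca.
    apply: eq_wsum => s _ /=; rewrite take0 !inE wweight_cons.
    by rewrite eq_sym (negbTE ba) eq_sym (negbTE ca) /= mulrCA.
  rewrite negbK in ca; rewrite -(mul0r (wsum n wweight)) -wsumZ.
  apply: eq_wsum => s _ /=.
  by rewrite !inE (eqP ca) eqxx !orbT !mul0r.
have -> : collapse x (iter n (extend x) (fun _ _ => 1)) b =
    \sum_(c | c != b) x c * ladder2 n b c.
  by apply: eq_bigr => c cb; rewrite IHn.
(* Both sides are the sum over all [c] with terms removed: [c = a] on the left, [c = b] and [c = a]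
   on the right. The term [c = b] vanishes by [ladder2_diag]. *)
have sumD1 d : \sum_(c | c != d) x c * ladder2 n b c =
    \sum_c x c * ladder2 n b c - x d * ladder2 n b d.
  by rewrite [in RHS](bigD1 d) //= addrAC subrr add0r.
by rewrite !sumD1 ladder2_diag mulr0 subr0.
Qed.

Lemma rooted_ladder n k :
  wsum n (fun s => (ladder_word (k :: s))%:R * wweight s) = gpair x n 0 0 k.
Proof.
case: n => [|n] /=.
  by rewrite /wweight big_nil elemsym0 erooted0.
rewrite (@eq_grow _ _ x n _ (fun _ _ => 1)) => [|u v _]; last by rewrite !erooted0 mulr1.
rewrite /grow /collapse (bigD1 k) //=.
have wE c : wsum n (fun s => (ladder_word [:: k, c & s])%:R * wweight (c :: s)) =
    x c * ladder2 n k c.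
  by rewrite -wsumZ; apply: eq_wsum => s _; rewrite wweight_cons mulrCA.
rewrite [X in X + _](_ : _ = 0) ?add0r; last first.
  by rewrite -(mulr0 (x k)) -(ladder2_diag n k) -wE.
apply: eq_bigr => c ck; rewrite -ladder2_extend // -wE.
by apply: eq_wsum.
Qed.

Lemma wsum_uniq (V : {set C}) b :
  wsum b (fun s => (uniq s && all (fun d => d \notin V) s)%:R * wweight s) =
  b`!%:R * elemsym x V b.
Proof.
elim: b V => [|b IHb] V /=; first by rewrite elemsym0 /wweight big_nil.
rewrite factS mulnC natrM -mulrA -sum_elemsym big_distrr /= [RHS]big_mkcond /=.
apply: eq_bigr => c _; case: ifPn => cV; last first.
  rewrite -(mul0r (wsum b wweight)) -wsumZ; apply: eq_wsum => s _.
  by rewrite /= andbF !mul0r.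
rewrite mulrCA -IHb -wsumZ; apply: eq_wsum => s _.
rewrite wweight_cons mulrCA; congr (_ * (_%:R * _)); congr (nat_of_bool _).
have -> : all (fun d => d \notin c |: V) s = (c \notin s) && all (fun d => d \notin V) s.
  rewrite -has_pred1 -all_predC -all_predI; apply: eq_all => d /=.
  by rewrite !inE negb_or.
by rewrite /= -andbA andbCA.
Qed.

(** A set partition into intervals, coded as a word of block labels: [uniq (zip (labels a lam) s)]
    then says that [s] is injective on every block. *)
Fixpoint labels (a : nat) (lam : seq nat) : seq nat :=
  if lam is l :: lam' then nseq l a ++ labels a.+1 lam' else [::].

Lemma size_labels a lam : size (labels a lam) = sumn lam.
Proof. by elim: lam a => //= l lam IHlam a; rewrite size_cat size_nseq IHlam. Qed.

Lemma labels_ge a lam b : b \in labels a lam -> (a <= b)%N.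
Proof.
elim: lam a => //= l lam IHlam a; rewrite mem_cat mem_nseq.
by case/orP => [/andP[_ /eqP->]|/IHlam /ltnW].
Qed.

Lemma uniq_zip_labels a lam l (s1 s2 : seq C) : size s1 = l ->
  uniq (zip (labels a (l :: lam)) (s1 ++ s2)) =
  uniq s1 && uniq (zip (labels a.+1 lam) s2).
Proof.
move=> s1l; rewrite /= zip_cat ?size_nseq // cat_uniq.
have -> : zip (nseq l a) s1 = [seq (a, c) | c <- s1].
  by rewrite -s1l; elim: s1 {s1l} => //= c s1 ->.
rewrite map_inj_uniq => [|c d []//]; congr (_ && _).
rewrite (_ : has _ _ = false) //; apply/hasP => -[[b d] bd /mapP[c _ [ba _]]].
have := map_f fst bd; rewrite -/(unzip1 _) => b_in.
suff /labels_ge : b \in labels a.+1 lam by rewrite ba ltnn.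
move: b_in; elim: (labels _ _) (s2) => [|y s IHs] [|z t] //=.
by rewrite !inE => /orP[->//|/IHs ->]; rewrite orbT.
Qed.

Lemma wsum_labels a lam :
  wsum (sumn lam) (fun s => (uniq (zip (labels a lam) s))%:R * wweight s) =
  \prod_(l <- lam) (l`!%:R * elemsym x set0 l).
Proof.
elim: lam a => [|l lam IHlam] a.
  by rewrite /= /wweight !big_nil mulr1.
rewrite big_cons -(IHlam a.+1) -wsum_uniq mulrC -wsumZ wsum_cat.
apply: eq_wsum => s1 s1l; rewrite mulrC -wsumZ; apply: eq_wsum => s2 _.
rewrite uniq_zip_labels // wweight_cat.
have -> : all (fun d => d \notin set0) s1 by apply/allP => c _; rewrite !inE.
by rewrite andbT -mulnb natrM; ring.
Qed.

Lemma wsum_rooted_labels lam j k :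
  wsum (j + sumn lam)
    (fun s => (uniq (zip (labels 0 (j.+1 :: lam)) (k :: s)))%:R * wweight s) =
  (j`! * \prod_(l <- lam) l`!)%:R * rooted_term (lam, j) x k.
Proof.
transitivity ((j`!%:R * elemsym x [set k] j) *
    \prod_(l <- lam) (l`!%:R * elemsym x set0 l)); last first.
  by rewrite big_split natrM natr_prod /rooted_term /erooted /=; ring.
rewrite -(wsum_labels 1) -wsum_uniq mulrC -wsumZ wsum_cat.
apply: eq_wsum => s1 s1l; rewrite mulrC -wsumZ; apply: eq_wsum => s2 _.
rewrite -cat_cons uniq_zip_labels /= ?s1l // wweight_cat.
have -> : all (fun d => d \notin [set k]) s1 = (k \notin s1).
  rewrite -has_pred1 -all_predC; apply: eq_all => d /=.
  by rewrite !inE.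
by rewrite -mulnb natrM [_ && uniq s1]andbC; ring.
Qed.

End WordSums.

(** * Set partitions coming from labellings *)

Section SetPartitions.

Variable n : nat.
Implicit Types (P : {set {set 'I_n}}) (w : 'I_n -> nat).

Lemma pblock_setpart P i : setpart P -> pblock P i \in P.
Proof. by move=> /cover_partition cP; rewrite pblock_mem // cP inE. Qed.

Lemma mem_setpart P i : setpart P -> i \in pblock P i.
Proof. by move=> /cover_partition cP; rewrite mem_pblock cP inE. Qed.

Lemma eNC_pblock P w : setpart P ->
  eNC P w = [forall i, forall j in pblock P i, (i != j) ==> (w i != w j)]%:R.
Proof.
move=> partP; have /and3P[_ tiP _] := partP.
rewrite /eNC; congr (nat_of_bool _)%:R; apply/idP/idP.
  move=> /forall_inP wP; apply/forallP => i.
  by have /forall_inP/(_ i (mem_setpart i partP)) := wP _ (pblock_setpart i partP).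
move=> /forallP wP; apply/forall_inP => B BP; apply/forall_inP => i iB.
by have := wP i; rewrite (def_pblock tiP BP iB).
Qed.

Definition label_part (lab : 'I_n -> nat) : {set {set 'I_n}} :=
  preim_partition lab [set: 'I_n].

Lemma label_part_setpart lab : setpart (label_part lab).
Proof. exact: preim_partitionP. Qed.

Lemma eNC_label_part lab w :
  eNC (label_part lab) w = (uniq (zip (word lab) (word w)))%:R.
Proof.
rewrite eNC_pblock ?label_part_setpart //; congr (nat_of_bool _)%:R.
have -> : zip (word lab) (word w) = word (fun i => (lab i, w i)).
  by rewrite /word; elim: (enum _) => //= i s ->.
have mem_lab i j : (j \in pblock (label_part lab) i) = (lab i == lab j).
  rewrite pblock_equivalence_partition ?in_setT // => u v z _ _ _.
  by split=> // /eqP->.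
apply/forallP/injectiveP => [wP i j [lab_ij w_ij]|w_inj i].
  apply: rev_ord_inj; apply/eqP; apply: contraTT (eqxx (w (rev_ord i))) => ij.
  have /forall_inP/(_ (rev_ord j)) := wP (rev_ord i).
  by rewrite mem_lab lab_ij ij -w_ij; apply.
apply/forall_inP => j; rewrite mem_lab => /eqP lab_ij; apply/implyP.
apply: contraNN => /eqP w_ij; have := w_inj (rev_ord i) (rev_ord j).
by rewrite !rev_ordK lab_ij w_ij => /(_ erefl) /rev_ord_inj ->.
Qed.

End SetPartitions.

(** * Rooted generating functions and averages over permutations fixing the last vertex *)

Section RootedWords.

Variables (R : comNzRingType) (C : finType) (x : C -> R) (n : nat).

Lemma wordS T (w : 'I_n.+1 -> T) :
  word w = w ord_max :: [seq w (rev_ord (lift ord0 i)) | i <- enum 'I_n].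
Proof.
rewrite /word enum_ordSl /= -map_comp; congr (w _ :: _).
by apply: val_inj; rewrite /= subn1.
Qed.

Lemma wsum_rooted (F : seq C -> R) k :
  \sum_(w : {ffun 'I_n.+1 -> C} | w ord_max == k)
     F (word w) * \prod_(i | i != ord_max) x (w i) =
  wsum n (fun s => F (k :: s) * wweight x s).
Proof.
(* The root carries no weight, hence [behead]; the condition on its colour moves into the summand so
   that [wsum_ffun] applies. *)
transitivity (wsum n.+1 (fun s => (head k s == k)%:R * (F s * wweight x (behead s)))).
  rewrite -wsum_ffun big_mkcond /=; apply: eq_bigr => w _.
  rewrite wordS /=; case: eqP => wk; rewrite ?mul0r // mul1r -wordS; congr (_ * _).
  rewrite /wweight big_map enumT [LHS](reindex_inj rev_ord_inj) /= big_mkcond big_ord_recl /=.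
  have -> : rev_ord ord0 = ord_max :> 'I_n.+1 by apply: val_inj; rewrite /= subn1.
  rewrite eqxx mul1r; apply: eq_bigr => i _.
  by rewrite -(inj_eq rev_ord_inj) rev_ordK -val_eqE /= /bump subnn.
rewrite /= (bigD1 k) //= [X in _ + X]big1 ?addr0 => [|c /negbTE ck].
  by apply: eq_wsum => s _; rewrite eqxx mul1r.
rewrite -(mul0r (wsum n (wweight x))) -wsumZ; by apply: eq_wsum => s _; rewrite ck !mul0r.
Qed.

End RootedWords.

Section Polynomials.

Variables (n : nat).
Implicit Types f g : ncseries n.+1.

Definition rooted_gf q m (x : 'I_m -> {mpoly rat[q]}) f (k : 'I_m) : {mpoly rat[q]} :=
  \sum_(w : {ffun 'I_n.+1 -> 'I_m} | w ord_max == k)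
     f (fun i => val (w i)) *: \prod_(i | i != ord_max) x (w i).

Lemma rooted_gf_YG q m (x : 'I_m -> {mpoly rat[q]}) k :
  rooted_gf x (YG (tl_adj n.+1)) k = gpair x n 0 0 k.
Proof.
rewrite -rooted_ladder -(wsum_rooted x n (fun s => (ladder_word s)%:R)).
apply: eq_bigr => w _; rewrite /YG proper_ladder_word.
rewrite (word_map val) ladder_word_map; last exact: val_inj.
by rewrite scaler_nat mulr_natl.
Qed.

Definition type_labels (p : seq nat * nat) : seq nat := labels 0 (p.2.+1 :: p.1).

(** A representative of the type [p]: because of [rev_ord], label 0 falls on the last [p.2.+1]
    vertices, which form the root block. *)
Definition type_part (p : seq nat * nat) : {set {set 'I_n.+1}} :=
  label_part (fun i => nth 0%N (type_labels p) (rev_ord i)).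

(** Number of ways to order the colours inside the blocks once the root's colour is fixed. *)
Definition type_fact (p : seq nat * nat) : nat := (p.2`! * \prod_(l <- p.1) l`!)%N.

Lemma rooted_gf_type_part q m (x : 'I_m -> {mpoly rat[q]}) p k :
  rooted_type n.+1 p ->
  rooted_gf x (eNC (type_part p)) k = (type_fact p)%:R * rooted_term p x k.
Proof.
case: p => lam j /andP[/= _ /eqP sz]; rewrite -wsum_rooted_labels.
have -> : (j + sumn lam = n)%N by lia.
rewrite -(wsum_rooted x n (fun s => (uniq (zip (labels 0 (j.+1 :: lam)) s))%:R)).
apply: eq_bigr => w _; rewrite eNC_label_part word_nth; last first.
  by rewrite size_labels /=; lia.
rewrite (word_map val) scaler_nat mulr_natl; congr (_ *+ nat_of_bool _).
set L := labels _ _.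
have -> : zip L (map val (word w)) = [seq (c.1, val c.2) | c <- zip L (word w)].
  by elim: (L) (word w) => [|a s IHs] [|b t] //=; rewrite IHs.
by rewrite map_inj_uniq // => -[a b] [a' b'] [-> /val_inj ->].
Qed.

(** Polarization: the weight of a colour [c] is the sum of the variables of the non-root positions
    that [w0] colours [c]. Expanding the products chooses a position [t i] for each [i], and the
    coefficient of the product of all variables keeps exactly the permutations. *)
Lemma sum_perm_fix_last f (m : nat) (w0 : 'I_n.+1 -> 'I_m) :
  (forall w w', w =1 w' -> f w = f w') ->
  \sum_(s : 'S_n.+1 | s ord_max == ord_max) f (fun i => val (w0 (s i))) =
  ('X_ord_max * rooted_gf (fun c => \sum_(j | (j != ord_max) && (w0 j == c)) 'X_j)
     f (w0 ord_max))@_[multinom 1%N | i < n.+1].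
Proof.
(* [Z] offers only ['X_ord_max] at the last position and only the other variables elsewhere, so the
   root factor joins a single product over all positions. *)
move=> f_ext; pose Z (i : 'I_n.+1) (c : 'I_m) : {mpoly rat[n.+1]} :=
  \sum_(j : 'I_n.+1 | ((j == ord_max) == (i == ord_max)) && (w0 j == c)) 'X_j.
have -> : 'X_ord_max * rooted_gf (fun c => \sum_(j | (j != ord_max) && (w0 j == c)) 'X_j)
     f (w0 ord_max) =
   \sum_(w : {ffun 'I_n.+1 -> 'I_m}) f (fun i => val (w i)) *: \prod_i Z i (w i).
  rewrite /rooted_gf big_distrr big_mkcond /=; apply: eq_bigr => w _.
  rewrite [X in _ = _ *: X](bigD1 ord_max) //= /Z eqxx.
  case: ifPn => wk.
    rewrite -scalerAr; congr (_ *: (_ * _)).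
      rewrite (big_pred1 ord_max) // => j /=.
      by rewrite eqb_id; case: eqP => //= ->; rewrite eq_sym.
    by apply: eq_bigr => i /negbTE ->; apply: eq_bigl => j; rewrite eqbF_neg.
  rewrite [X in _ *: (X * _)]big_pred0 ?mul0r ?scaler0 // => j.
  rewrite eqb_id; case: eqP => //= ->; rewrite eq_sym; exact: negbTE.
transitivity ((\sum_(t : {ffun 'I_n.+1 -> 'I_n.+1} |
     [forall i, (t i == ord_max) == (i == ord_max)])
   f (fun i => val (w0 (t i))) *: \prod_i ('X_(t i) : {mpoly rat[n.+1]}))
   @_[multinom 1%N | i < n.+1]); last first.
  congr (mcoeff _ _).
  pose Qw (w : {ffun 'I_n.+1 -> 'I_m}) (t : {ffun 'I_n.+1 -> 'I_n.+1}) :=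
    [forall i, (t i == ord_max) == (i == ord_max)] && (w == [ffun i => w0 (t i)]).
  transitivity (\sum_(w : {ffun 'I_n.+1 -> 'I_m}) \sum_(t | Qw w t)
     f (fun i => val (w i)) *: \prod_i ('X_(t i) : {mpoly rat[n.+1]})); last first.
    apply: eq_bigr => w _; rewrite /Z bigA_distr_big_dep scaler_sumr.
    apply: eq_bigl => t; apply/andP/familyP => [[/forallP tP /eqP->] i|tP].
      by rewrite ffunE unfold_in tP eqxx.
    split; first by apply/forallP => i; have /andP[] := tP i.
    by apply/eqP/ffunP => i; have /andP[_ /eqP <-] := tP i; rewrite ffunE.
  rewrite (exchange_big_dep (fun t : {ffun 'I_n.+1 -> 'I_n.+1} =>
     [forall i, (t i == ord_max) == (i == ord_max)])) /=; last first.
    by move=> w t _ /andP[].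
  apply: eq_bigr => t tP; rewrite (big_pred1 [ffun i => w0 (t i)]) => [|w].
    by congr (_ *: _); apply: f_ext => i; rewrite ffunE.
  by rewrite /Qw tP.
rewrite raddf_sum /=.
have coefE (t : {ffun 'I_n.+1 -> 'I_n.+1}) :
    (f (fun i => val (w0 (t i))) *: \prod_i ('X_(t i) : {mpoly rat[n.+1]}))
    @_[multinom 1%N | i < n.+1] =
    if injectiveb t then f (fun i => val (w0 (t i))) else 0.
  rewrite mcoeffZ mprodXE mcoeffX.
  rewrite (_ : (_ == _) = injectiveb t); first by case: ifP; rewrite ?mulr1 ?mulr0.
  have sumE j : (\sum_i U_(t i))%MM j = #|[set i | t i == j]|.
    by rewrite mnm_sumE -sum1dep_card [RHS]big_mkcond /=; apply: eq_bigr => i _; rewrite mnm1E; case: eqP.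
  apply/eqP/injectiveP => [/mnmP tE i i' tii'|t_inj].
    have := tE (t i); rewrite sumE mnmE => /eqP /cards1P[u] uE.
    have : i \in [set u] by rewrite -uE inE.
    have : i' \in [set u] by rewrite -uE inE tii'.
    by rewrite !inE => /eqP-> /eqP->.
  apply/mnmP => j; rewrite sumE mnmE.
  have [t' t'K tK] := injF_bij t_inj; apply/eqP/cards1P; exists (t' j).
  by apply/setP => i; rewrite !inE; apply/eqP/eqP => [<-|->]; rewrite ?t'K ?tK.
rewrite (eq_bigr _ (fun t _ => coefE t)) -big_mkcondr /=.
rewrite (reindex (fun s : 'S_n.+1 => pval s)) /=; last first.
  exists (insubd (1%g : 'S_n.+1)) => [s _|t /andP[_ t_inj]].
    exact: valKd.
  rewrite -[pval _]/(val _); apply: insubdK; exact: t_inj.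
apply: eq_big => [s|s _]; last first.
  by apply: f_ext => i; rewrite pvalE.
have -> : injectiveb (pval s).
  by apply/injectiveP => i j; rewrite !pvalE => /perm_inj.
rewrite andbT; apply/eqP/forallP => [s_last i|sP]; last first.
  by apply/eqP; have := sP ord_max; rewrite pvalE eqxx eqb_id.
by rewrite pvalE -{1}s_last (inj_eq perm_inj).
Qed.

End Polynomials.

Lemma sum_perm_fix_last_eq n (f g : ncseries n.+1) :
  (forall w w', w =1 w' -> f w = f w') -> (forall w w', w =1 w' -> g w = g w') ->
  (forall q m (x : 'I_m -> {mpoly rat[q]}), rooted_gf x f =1 rooted_gf x g) ->
  forall w : 'I_n.+1 -> nat,
    \sum_(s : 'S_n.+1 | s ord_max == ord_max) f (fun i => w (s i)) =
    \sum_(s : 'S_n.+1 | s ord_max == ord_max) g (fun i => w (s i)).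
Proof.
(* A word uses finitely many colours, so the colour set can be cut off at their maximum. *)
move=> f_ext g_ext fg w; pose w0 i : 'I_(\max_i w i).+1 := inord (w i).
have w0E i : val (w0 i) = w i by rewrite /= inordK // ltnS leq_bigmax.
have avgE h : (forall w w', w =1 w' -> h w = h w') ->
    \sum_(s : 'S_n.+1 | s ord_max == ord_max) h (fun i => w (s i)) =
    \sum_(s : 'S_n.+1 | s ord_max == ord_max) h (fun i => val (w0 (s i))).
  by move=> h_ext; apply: eq_bigr => s _; apply: h_ext => i; rewrite w0E.
by rewrite !avgE // !sum_perm_fix_last // fg.
Qed.

(** * The commutative image and e-positivity of the chromatic symmetric function *)

Section CommutativeImage.

Variable m : nat.
Implicit Type alpha : 'I_m -> nat.

Let X (i : 'I_m) : {mpoly rat[m]} := 'X_i.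

Lemma mcoeff_prod_X (I : finType) (P : pred I) (t : I -> 'I_m) alpha :
  (\prod_(i | P i) X (t i))@_[multinom alpha i | i < m] =
  [forall j, #|[set i | P i && (t i == j)]| == alpha j]%:R.
Proof.
rewrite mprodXE mcoeffX; congr (nat_of_bool _)%:R.
have sumE j : (\sum_(i | P i) U_(t i))%MM j = #|[set i | P i && (t i == j)]|.
  rewrite mnm_sumE -sum1dep_card big_mkcondr /=; apply: eq_bigr => i _.
  by rewrite mnm1E; case: eqP.
apply/eqP/forallP => [/mnmP tE j|tE]; first by rewrite -sumE tE mnmE.
by apply/mnmP => j; rewrite sumE mnmE; apply/eqP.
Qed.

Lemma eSym_mcoeff lam alpha :
  eSym lam alpha = (\prod_(l <- lam) elemsym X set0 l)@_[multinom alpha i | i < m].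
Proof.
rewrite (big_nth 0%N) big_mkord /elemsym bigA_distr_big_dep raddf_sum /=.
rewrite /eSym -sum1dep_card natr_sum big_mkcondr /=.
apply: eq_big => [S|S _].
  apply/forallP/familyP => SP i; have := SP i; rewrite unfold_in.
    by move=> ->; rewrite disjoint_sym disjoints_subset sub0set.
  by case/andP.
rewrite (pair_big_dep xpredT (fun i c => c \in S i) (fun i c => X c)) /=.
rewrite (mcoeff_prod_X (fun p : 'I_(size lam) * 'I_m => p.2 \in S p.1) snd).
rewrite [in RHS](eq_forallb (P2 := fun j => #|[set i | j \in S i]| == alpha j)) => [|j].
  by case: ifP.
congr (_ == _); rewrite -[RHS](card_imset _ (f := fun i => (i, j))) => [|i i' []//].
apply: eq_card => -[i c]; rewrite !inE /=; apply/andP/imsetP => [[cS /eqP cj]|[i' iS [-> ->]]].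
  by exists i; rewrite ?inE -cj.
by rewrite inE in iS; rewrite iS.
Qed.

Lemma XG_mcoeff n alpha :
  XG (tl_adj n.+1) alpha =
  (\sum_k X k * gpair X n 0 0 k)@_[multinom alpha i | i < m].
Proof.
have -> : \sum_k X k * gpair X n 0 0 k =
  \sum_(w : {ffun 'I_n.+1 -> 'I_m} | proper_word (tl_adj n.+1) (fun i => val (w i)))
    \prod_i X (w i).
  transitivity (\sum_k \sum_(w : {ffun 'I_n.+1 -> 'I_m} | w ord_max == k)
     YG (tl_adj n.+1) (fun i => val (w i)) *: \prod_i X (w i)).
    apply: eq_bigr => k _; rewrite -rooted_gf_YG /rooted_gf big_distrr /=.
    apply: eq_bigr => w /eqP <-; rewrite -scalerAr; congr (_ *: _).
    by rewrite [RHS](bigD1 ord_max).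
  rewrite (exchange_big_dep xpredT) //= [RHS]big_mkcond /=; apply: eq_bigr => w _.
  rewrite (big_pred1 (w ord_max)) => [|k]; last by rewrite eq_sym.
  by rewrite /YG; case: ifP; rewrite ?scale1r ?scale0r.
rewrite raddf_sum /= /XG -sum1dep_card natr_sum big_mkcondr /=.
apply: eq_bigr => w _; rewrite (mcoeff_prod_X xpredT w).
by case: ifP.
Qed.

End CommutativeImage.

Lemma XG_e_positive n : e_positive n.+1 (XG (tl_adj n.+1)).
Proof.
have [s [sP sE]] := gpair_positive n 0.
(* Restoring the root's weight and summing over its colour turns [A_j] into [(j + 1) e_(j+1)] by
   [sum_erooted]: the root block becomes a part [p.2.+1] with coefficient [p.2.+1]. Sorting produces
   an integer partition. *)
exists [seq (sort geq (p.2.+1 :: p.1), p.2.+1%:R) | p <- s]; split.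
  rewrite all_map; apply: sub_all sP => p /andP[p1 /eqP psum] /=.
  rewrite ler0n andbT /is_intpart sort_sorted => [|a b]; last exact: leq_total.
  have sort_p := permEl (perm_sort geq (p.2.+1 :: p.1)).
  rewrite (perm_all _ sort_p) (perm_sumn sort_p) /= p1 /=; apply/eqP; lia.
move=> m alpha; rewrite XG_mcoeff big_map.
transitivity ((\sum_(p <- s) p.2.+1%:R *:
   \prod_(l <- p.2.+1 :: p.1) elemsym (fun i => 'X_i : {mpoly rat[m]}) set0 l)
   @_[multinom alpha i | i < m]).
  congr (mcoeff _ _); under eq_bigr => k _ do rewrite sE big_distrr /=.
  rewrite exchange_big /=; apply: eq_bigr => p _.
  rewrite big_cons scaler_nat -mulr_natl mulrA -sum_erooted big_distrl /=.
  by apply: eq_bigr => k _; rewrite /rooted_term; ring.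
rewrite raddf_sum /=; apply: eq_bigr => p _.
rewrite mcoeffZ eSym_mcoeff; congr (_ * mcoeff _ _).
by apply: perm_big; rewrite perm_sym; apply/permEl/perm_sort.
Qed.

(** * Expansion of [YG] in the elementary basis through power sums *)

Section ElementarySpan.

Variable n : nat.
Implicit Types (f g : ncseries n) (P : {set {set 'I_n}}) (w : 'I_n -> nat).

Definition in_espan f := exists c, ecoeffs f c.

Lemma in_espan_lin a f g h : (forall w, h w = a * f w + g w) ->
  in_espan f -> in_espan g -> in_espan h.
Proof.
move=> hE [c cE] [d dE]; exists (fun P => a * c P + d P) => w.
rewrite hE cE dE big_distrr -big_split /=; apply: eq_bigr => P _; ring.
Qed.

Lemma in_espan0 : in_espan (fun=> 0).
Proof. by exists (fun=> 0) => w; rewrite big1 // => P _; rewrite mul0r. Qed.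

Lemma in_espan_sum (I : finType) (A : pred I) (a : I -> rat) (f : I -> ncseries n) :
  (forall i, A i -> in_espan (f i)) ->
  in_espan (fun w => \sum_(i | A i) a i * f i w).
Proof.
move=> fA; have: forall i, i \in enum A -> in_espan (f i).
  by move=> i; rewrite mem_enum; apply: fA.
move=> {fA} fA.
have: in_espan (fun w => \sum_(i <- enum A) a i * f i w); last first.
  by move=> [c cE]; exists c => w; rewrite -cE big_enum.
elim: (enum A) fA => [|i s IHs] fA.
  by case: in_espan0 => c cE; exists c => w; rewrite big_nil; exact: cE.
apply: (@in_espan_lin (a i) (f i) (fun w => \sum_(j <- s) a j * f j w)) => [w||].
- by rewrite big_cons.
- by apply: fA; rewrite mem_head.
- by apply: IHs => j js; apply: fA; rewrite inE js orbT.
Qed.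

Lemma in_espan_eNC P : setpart P -> in_espan (eNC P).
Proof.
move=> partP; exists (fun Q => (Q == P)%:R) => w.
rewrite (bigD1 P) //= eqxx mul1r big1 ?addr0 // => Q /andP[_ /negbTE->].
by rewrite mul0r.
Qed.

(** The power sum indexed by [P] in non-commuting variables. *)
Definition pNC P : ncseries n :=
  fun w => [forall i, forall j in pblock P i, w i == w j]%:R.

Definition youngb P (s : 'S_n) := [forall i, s i \in pblock P i].

(* The permutations of [P]'s Young subgroup fixing the word [w] form a group,
   which is trivial if [w] is injective on the blocks and contains a
   transposition otherwise. *)
Lemma eNC_signed_sum P w : setpart P ->
  eNC P w = \sum_(s | youngb P s) (-1) ^+ s * [forall i, w (s i) == w i]%:R.
Proof.
move=> partP; have /and3P[_ tiP _] := partP.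
have same i j : i \in pblock P j -> pblock P i = pblock P j.
  by move=> /(same_pblock tiP).
rewrite eNC_pblock //.
have [wP|] := boolP [forall i, forall j in pblock P i, (i != j) ==> (w i != w j)].
  have y1 : youngb P 1%g by apply/forallP => i; rewrite perm1 mem_setpart.
  rewrite (bigD1 1%g) //= odd_perm1 expr0 mul1r.
  have -> : [forall i, w ((1%g : 'S_n) i) == w i] by apply/forallP => i; rewrite perm1.
  rewrite big1 ?addr0 // => s /andP[/forallP ys s1].
  have [/forallP ws|_] := boolP [forall i, w (s i) == w i]; last by rewrite mulr0.
  case/eqP: s1; apply/permP => i; rewrite perm1; apply/eqP.
  apply: contraTT (ws i) => si; rewrite eq_sym.
  have /forall_inP/(_ (s i) (ys i)) := forallP wP i.
  by rewrite eq_sym si.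
rewrite negb_forall => /existsP[i]; rewrite negb_forall_in => /exists_inP[j ij].
rewrite negb_imply negbK => /andP[neq_ij /eqP wij].
set S := \sum_(s | _) _.
suff : S = - S by move/eqP; rewrite -addr_eq0 -mulr2n mulrn_eq0 /= => /eqP->.
have same_ij : pblock P j = pblock P i by apply: same.
have pblock_t x : pblock P (tperm i j x) = pblock P x by case: tpermP => [->|->|].
have w_t x : w (tperm i j x) = w x by case: tpermP => [->|->|].
rewrite /S [LHS](reindex_inj (mulgI (tperm i j))) -sumrN /=.
apply: eq_big => [s|s _].
  apply/forallP/forallP => ys x; last by rewrite permM -pblock_t ys.
  by have := ys (tperm i j x); rewrite permM tpermK pblock_t.
rewrite odd_permM odd_tperm neq_ij signr_addb expr1 mulN1r mulNr.
congr (- (_ * (nat_of_bool _)%:R)).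
apply/forallP/forallP => ws x; last by rewrite permM -(w_t x) ws.
by have := ws (tperm i j x); rewrite permM tpermK w_t.
Qed.

Definition gpart (e : rel 'I_n) := equivalence_partition (connect e) [set: 'I_n].

Section GeneratedPartition.

Variable e : rel 'I_n.
Hypothesis e_sym : connect_sym e.

Let connect_equiv : {in [set: 'I_n] & &, equivalence_rel (connect e)}.
Proof.
move=> x y z _ _ _; split=> [|xy]; first exact: connect0.
exact: (same_connect e_sym xy).
Qed.

Lemma gpart_setpart : setpart (gpart e).
Proof. exact: equivalence_partitionP. Qed.

Lemma pblock_gpart i j : (j \in pblock (gpart e) i) = connect e i j.
Proof. by rewrite pblock_equivalence_partition ?in_setT. Qed.

Lemma pNC_gpart w :
  pNC (gpart e) w = [forall i, forall j, e i j ==> (w i == w j)]%:R.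
Proof.
congr (nat_of_bool _)%:R; apply/forallP/forallP => we i.
  apply/forallP => j; apply/implyP => eij.
  have /forall_inP/(_ j) := we i.
  by rewrite pblock_gpart; apply; apply: connect1.
apply/forall_inP => j; rewrite pblock_gpart => ij.
have w_closed : closed e [pred k | w k == w i].
  move=> x y exy; rewrite !inE.
  by have /forallP/(_ y)/implyP/(_ exy)/eqP-> := we x.
by have := closed_connect w_closed ij; rewrite !inE eqxx eq_sym => <-.
Qed.

End GeneratedPartition.

Lemma eq_setpart P Q : setpart P -> setpart Q ->
  (forall i, pblock P i = pblock Q i) -> P = Q.
Proof.
move=> partP partQ PQ.
have imE R : setpart R -> R = [set pblock R i | i : 'I_n].
  move=> partR; have /and3P[_ tiR R0] := partR; apply/setP => B.
  apply/idP/imsetP => [BR|[i _ ->]]; last exact: pblock_setpart.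
  have /set0Pn[i iB] : B != set0 by apply: contraNneq R0 => <-.
  by exists i; rewrite ?(def_pblock tiR BR iB).
by rewrite (imE P) // (imE Q) //; apply: eq_imset.
Qed.

Definition cycle_part (s : 'S_n) := gpart (frel s).

Let frel_sym (s : 'S_n) : connect_sym (frel s).
Proof. by apply: fconnect_sym; exact: perm_inj. Qed.

Lemma porbits_cycle_part s : porbits s = cycle_part s.
Proof.
have porbitE i : porbit s i = [set j in [set: 'I_n] | fconnect s i j].
  apply/setP => j; rewrite inE in_setT /=.
  apply/porbitP/idP => [[k ->]|/iter_findex <-].
    by rewrite permX fconnect_iter.
  by exists (findex s i j); rewrite permX.
by apply/setP => B; apply/imsetP/imsetP => -[i _ ->]; exists i; rewrite ?in_setT.
Qed.

Lemma pNC_cycle_part s w : pNC (cycle_part s) w = [forall i, w (s i) == w i]%:R.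
Proof.
rewrite pNC_gpart //; congr (nat_of_bool _)%:R.
apply/forallP/forallP => ws i.
  by have /forallP/(_ (s i)) := ws i; rewrite /= eqxx eq_sym.
by apply/forallP => j; apply/implyP => /eqP <-; rewrite eq_sym.
Qed.

(** Rotating every block along its enumeration gives such a permutation; it guarantees that [pNC P]
    really occurs in the signed sum for [eNC P]. *)
Lemma exists_cycle_part P : setpart P ->
  exists2 s, youngb P s & cycle_part s = P.
Proof.
move=> partP; have /and3P[_ tiP _] := partP.
have same i j : i \in pblock P j -> pblock P i = pblock P j.
  by move=> /(same_pblock tiP).
pose c i := enum (pblock P i).
have c_uniq i : uniq (c i) by exact: enum_uniq.
have next_in i : next (c i) i \in pblock P i.
  by rewrite -mem_enum mem_next mem_enum mem_setpart.
have next_inj : injective (fun i => next (c i) i).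
  move=> i j eq_ij; have cij : c i = c j.
    by rewrite /c -(same _ _ (next_in i)) eq_ij (same _ _ (next_in j)).
  by rewrite -(prev_next (c_uniq i) i) eq_ij cij prev_next.
have sE i : perm next_inj i = next (c i) i by rewrite permE.
exists (perm next_inj); first by apply/forallP => i; rewrite sE.
apply: eq_setpart => // [|i]; first exact: gpart_setpart.
apply/setP => j; rewrite pblock_gpart //.
rewrite (@fconnect_cycle _ _ (c i)) ?mem_enum ?mem_setpart //.
rewrite (@eq_in_cycle _ (mem (c i)) _ (frel (next (c i)))).
- exact: cycle_next.
- by move=> x y; rewrite !mem_enum => xi yi; rewrite /= sE /c (same _ _ xi).
- by apply/allP.
Qed.

(** In the signed sum for [eNC P] the permutations with cycle partition [P] contribute a nonzero
    multiple of [pNC P], and all others have a strictly finer cycle partition. Solving for [pNC P]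
    gives an induction on the number of pairs lying in a common block. *)
Lemma in_espan_pNC P : setpart P -> in_espan (pNC P).
Proof.
pose pairs P := [set p : 'I_n * 'I_n | p.2 \in pblock P p.1].
have [m] := ubnP #|pairs P|; elim: m P => // m IHm P leP partP.
have /and3P[_ tiP _] := partP.
pose good s := youngb P s && (cycle_part s == P).
pose N := #|[set s | good s]|.
(* The sign of a permutation depends only on its number of cycles, so the terms with cycle partition
   [P] share this sign and cannot cancel. *)
pose sg : rat := (-1) ^+ (odd n (+) odd #|P|).
have N_gt0 : (0 < N)%N.
  have [s ys sP] := exists_cycle_part partP.
  by apply/card_gt0P; exists s; rewrite inE /good ys sP eqxx.
have NE : sg * N%:R != 0 :> rat.
  by rewrite mulf_neq0 ?signr_eq0 // pnatr_eq0 -lt0n.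
apply: (@in_espan_lin (sg * N%:R)^-1 (fun w => -1 *
   (\sum_(s | youngb P s && (cycle_part s != P)) (-1) ^+ s * pNC (cycle_part s) w)
   + eNC P w) (fun=> 0)); last exact: in_espan0.
  move=> w; rewrite addr0 eNC_signed_sum //.
  under [in RHS]eq_bigr => s _ do rewrite pNC_cycle_part.
  rewrite [X in _ + X](bigID (fun s => cycle_part s == P)) /= mulN1r addrCA addNr addr0.
  rewrite (eq_bigr (fun=> sg * pNC P w)) => [|s /andP[ys /eqP sP]].
    rewrite sumr_const (_ : #|_| = N); last by rewrite /N cardsE.
    by rewrite -[(sg * _) *+ N]mulr_natr mulrAC mulKf.
  rewrite -pNC_cycle_part sP; congr (_ * _).
  by rewrite /sg -sP -porbits_cycle_part /odd_perm card_ord.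
apply: (in_espan_lin (fun w => erefl)); last exact: in_espan_eNC.
apply: in_espan_sum => s /andP[/forallP ys sP]; apply: IHm; last exact: gpart_setpart.
apply: leq_trans (_ : _ <= #|pairs P|)%N leP; apply: proper_card; rewrite properEneq; apply/andP; split.
  apply: contraNneq sP => pairsE; apply/eqP; apply: eq_setpart => // [|i].
    exact: gpart_setpart.
  by apply/setP => j; have /setP/(_ (i, j)) := pairsE; rewrite !inE.
apply/subsetP => -[i j]; rewrite !inE /= pblock_gpart // => /iter_findex <-.
elim: (findex _ _ _) => [|k IHk] /=; first exact: mem_setpart.
by rewrite -(same_pblock tiP IHk).
Qed.

(** Each factor [w i != w j] is expanded as 1 minus the indicator of [w i == w j]. Once no
    inequality remains, the equalities in [t] say that [w] is constant on the components they
    generate, which is a power sum. *)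
Lemma in_espan_YG (adj : rel 'I_n) : in_espan (YG adj).
Proof.
pose neqs (l : seq ('I_n * 'I_n)) w := all (fun p => w p.1 != w p.2) l.
pose eqs (l : seq ('I_n * 'I_n)) w := all (fun p => w p.1 == w p.2) l.
have span l t : in_espan (fun w => (neqs l w)%:R * (eqs t w)%:R).
  elim: l t => [|p l IHl] t.
    pose e i j := ((i, j) \in t) || ((j, i) \in t).
    have e_sym : connect_sym e by apply: sym_connect_sym => i j; rewrite /e orbC.
    have [c cE] := in_espan_pNC (gpart_setpart e_sym).
    exists c => w; rewrite -cE pNC_gpart // mul1r; congr (nat_of_bool _)%:R.
    apply/allP/forallP => [wt i|we [i j] ij /=].
      apply/forallP => j; apply/implyP => /orP[/wt //|/wt]; by rewrite eq_sym.
    by have /forallP/(_ j)/implyP := we i; apply; rewrite /e ij.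
  apply: (in_espan_lin (a := -1) _ (IHl (p :: t)) (IHl t)) => w /=.
  by case: (w p.1 == w p.2); case: (neqs l w); case: (eqs t w).
have [c cE] := span [seq p <- enum {:'I_n * 'I_n} | adj p.1 p.2] [::].
exists c => w; rewrite -cE mulr1; congr (nat_of_bool _)%:R.
apply/forallP/allP => [wP [i j]|wP i].
  by rewrite mem_filter => /andP[/= aij _]; have /forallP/(_ j)/implyP/(_ aij) := wP i.
apply/forallP => j; apply/implyP => aij.
by apply: (wP (i, j)); rewrite mem_filter /= aij mem_enum.
Qed.

End ElementarySpan.

(** * Permutation action on set partitions, and the semi-symmetrized conclusion *)

Section PermutedPartitions.

Variable n : nat.
Implicit Types (s : 'S_n) (P Q : {set {set 'I_n}}).

Definition perm_part s P : {set {set 'I_n}} := [set s @: B | B : {set 'I_n} in P].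

Let imset_perm_inj s : injective (fun B : {set 'I_n} => s @: B).
Proof. exact: imset_inj perm_inj. Qed.

Lemma perm_partK s : cancel (perm_part s) (perm_part s^-1%g).
Proof.
move=> P; rewrite /perm_part -imset_comp -[RHS]imset_id; apply: eq_imset => B /=.
by rewrite -imset_comp -[RHS]imset_id; apply: eq_imset => i /=; rewrite permK.
Qed.

Lemma perm_partKV s : cancel (perm_part s^-1%g) (perm_part s).
Proof. by move=> P; rewrite -{1}[s]invgK perm_partK. Qed.

Let setpart_sub s P : setpart P -> setpart (perm_part s P).
Proof.
move=> partP; have /and3P[_ /trivIsetP tiP P0] := partP; apply/and3P; split.
- rewrite eqEsubset subsetT; apply/subsetP => i _; apply/bigcupP.
  exists (s @: pblock P (s^-1%g i)); first by rewrite imset_f // pblock_setpart.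
  by rewrite -{1}(permKV s i) imset_f // mem_setpart.
- apply/trivIsetP => _ _ /imsetP[A AP ->] /imsetP[B BP ->] AB.
  rewrite imset_disjoint; [|exact: perm_inj].
  by apply: tiP => //; apply: contraNneq AB => ->.
by apply/imsetP => -[B BP /esym/eqP]; rewrite imset_eq0 => /eqP B0; rewrite -B0 BP in P0.
Qed.

Lemma setpart_perm_part s P : setpart (perm_part s P) = setpart P.
Proof.
apply/idP/idP; last exact: setpart_sub.
by move/(setpart_sub s^-1%g); rewrite perm_partK.
Qed.

Lemma eNC_perm_part s P (w : 'I_n -> nat) :
  eNC (perm_part s P) w = eNC P (fun i => w (s i)).
Proof.
congr (nat_of_bool _)%:R; apply/forall_inP/forall_inP => wP B BP.
  apply/forall_inP => i iB; apply/forall_inP => j jB.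
  have /forall_inP/(_ (s i) (imset_f _ iB)) := wP _ (imset_f _ BP).
  by move=> /forall_inP/(_ (s j) (imset_f _ jB)); rewrite (inj_eq perm_inj).
have /imsetP[A AP ->] := BP.
apply/forall_inP => _ /imsetP[i iA ->]; apply/forall_inP => _ /imsetP[j jA ->].
have /forall_inP/(_ i iA)/forall_inP/(_ j jA) := wP A AP.
by rewrite (inj_eq perm_inj).
Qed.

Lemma block_sizes_perm_part s P :
  perm_eq (block_sizes (perm_part s P)) (block_sizes P).
Proof.
have : perm_eq (enum (perm_part s P)) [seq s @: B | B : {set 'I_n} <- enum P].
  apply: uniq_perm; first exact: enum_uniq.
    by rewrite map_inj_uniq ?enum_uniq //; exact: imset_perm_inj.
  move=> A.
  rewrite mem_enum; apply/imsetP/mapP => -[B BP ->]; exists B => //.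
    by rewrite mem_enum.
  by rewrite mem_enum in BP.
move/(perm_map (fun B : {set 'I_n} => #|B|)) => /perm_trans; apply.
rewrite -map_comp (eq_map (g := fun B : {set 'I_n} => #|B|)) // => B /=.
by rewrite card_imset //; exact: perm_inj.
Qed.

End PermutedPartitions.

Lemma last_block_sizeE n (P : {set {set 'I_n.+1}}) :
  last_block_size P = #|pblock P ord_max|.
Proof.
rewrite /last_block_size; case: pickP => [x /eqP xn|/(_ ord_max)]; last by rewrite eqxx.
by rewrite (_ : x = ord_max) //; apply: val_inj.
Qed.

Lemma psim_perm_part n (s : 'S_n.+1) (P Q : {set {set 'I_n.+1}}) :
  setpart Q -> s ord_max = ord_max -> psim P (perm_part s Q) = psim P Q.
Proof.
move=> partQ s_last; rewrite /psim !last_block_sizeE; congr (_ && _).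
  by rewrite !(perm_sym (block_sizes P)); exact: (permPl (block_sizes_perm_part s Q)).
have /and3P[_ tiQ _] : setpart (perm_part s Q) by rewrite setpart_perm_part.
rewrite (def_pblock (B := s @: pblock Q ord_max) tiQ).
- by rewrite card_imset //; exact: perm_inj.
- by rewrite imset_f // pblock_setpart.
by rewrite -{1}s_last imset_f // mem_setpart.
Qed.

Lemma sum_perm_part n (s : 'S_n) (a : {set {set 'I_n}} -> rat) (w : 'I_n -> nat) :
  \sum_(P | setpart P) a (perm_part s P) * eNC P w =
  \sum_(P | setpart P) a P * eNC P (fun i => w ((s^-1)%g i)).
Proof.
rewrite [LHS](reindex (perm_part s^-1%g)) /=; last first.
  by apply: onW_bij; exists (perm_part s) => P; rewrite ?perm_partK ?perm_partKV.
apply: eq_big => [P|P _]; first by rewrite setpart_perm_part.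
by rewrite perm_partKV eNC_perm_part.
Qed.

(* Averaging over the permutations that fix the last vertex changes the
   coefficients only within the classes of [psim]. *)
Lemma semi_sym_e_positive_avg n (f : ncseries n.+1) (d : {set {set 'I_n.+1}} -> rat) :
  in_espan f -> (forall P, 0 <= d P) ->
  (forall w : 'I_n.+1 -> nat,
     \sum_(s : 'S_n.+1 | s ord_max == ord_max) f (fun i => w (s i)) =
     \sum_(s : 'S_n.+1 | s ord_max == ord_max)
        \sum_(P | setpart P) d P * eNC P (fun i => w (s i))) ->
  semi_sym_e_positive f.
Proof.
move=> [c0 c0E] d_ge0 avg.
pose g : ncseries n.+1 := fun w => \sum_(P | setpart P) d P * eNC P w.
exists g; split; last by exists d; split.
pose fix_last (s : 'S_n.+1) := s ord_max == ord_max.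
pose M : rat := #|[set s | fix_last s]|%:R.
have M_neq0 : M != 0.
  rewrite pnatr_eq0 -lt0n; apply/card_gt0P; exists 1%g.
  by rewrite inE /fix_last perm1.
have sumM (a : rat) : \sum_(s | fix_last s) a = M * a.
  by rewrite sumr_const mulr_natl /M cardsE.
(* The coefficients [c0] of [f] are corrected by the average of [d - c0] over the permutations
   fixing the last vertex. By [avg] the correction represents the zero series; averaging preserves
   class sums, so the corrected class sums are those of [d]. *)
exists (fun P => c0 P + M^-1 *
  \sum_(s | fix_last s) (d (perm_part s P) - c0 (perm_part s P))), d; split=> //.
- move=> w; under eq_bigr => P _ do rewrite mulrDl -mulrA big_distrl /=.
  rewrite big_split /= -c0E -big_distrr exchange_big /=.
  have -> : \sum_(s | fix_last s) \sum_(P | setpart P)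
      (d (perm_part s P) - c0 (perm_part s P)) * eNC P w = 0.
    under eq_bigr => s _ do
      (under eq_bigr => P _ do rewrite mulrBl;
       rewrite sumrB !sum_perm_part -c0E).
    (* [sum_perm_part] leaves the inverse of [s] inside the words, whereas [avg] is stated with
       [s]. *)
    rewrite sumrB (reindex_inj invg_inj) /= [X in _ - X](reindex_inj invg_inj) /=.
    have fixV s : fix_last s^-1%g = fix_last s.
      by rewrite /fix_last -{1}(inj_eq (@perm_inj _ s)) permKV eq_sym.
    under eq_bigl => s do rewrite fixV.
    under eq_bigr => s _ do under eq_bigr => P _ do rewrite invgK.
    under [X in _ - X]eq_bigl => s do rewrite fixV.
    under [X in _ - X]eq_bigr => s _ do rewrite invgK.
    by rewrite avg subrr.
  by rewrite mulr0 addr0.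
move=> P partP; rewrite big_split /= -big_distrr exchange_big /=.
have classE (a : {set {set 'I_n.+1}} -> rat) s : fix_last s ->
    \sum_(Q | setpart Q && psim P Q) a (perm_part s Q) =
    \sum_(Q | setpart Q && psim P Q) a Q.
  move=> /eqP s_last; rewrite [RHS](reindex (perm_part s)) /=; last first.
    by apply: onW_bij; exists (perm_part s^-1%g) => Q; rewrite ?perm_partK ?perm_partKV.
  apply: eq_bigl => Q; rewrite setpart_perm_part; case partQ: (setpart Q) => //=.
  by rewrite psim_perm_part.
rewrite (eq_bigr _ (fun s s_last => etrans (sumrB _ _ _ _)
  (congr2 (fun u v => u - v) (classE d s s_last) (classE c0 s s_last)))).
by rewrite sumM mulKf // addrC subrK.
Qed.

Lemma YG_semi_sym_e_positive n : semi_sym_e_positive (YG (tl_adj n.+1)).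
Proof.
have [s [sP sE]] := gpair_positive n 0; rewrite addn1 in sP.
(* The whole weight of a type is put on its representative; dividing by [type_fact] compensates the
   factor in [rooted_gf_type_part]. *)
pose d (P : {set {set 'I_n.+1}}) : rat :=
  \sum_(p <- s) (type_fact p)%:R^-1 * (P == type_part n p)%:R.
have fact_neq0 p : (type_fact p)%:R != 0 :> rat.
  rewrite pnatr_eq0 -lt0n /type_fact muln_gt0 fact_gt0 /=.
  by apply: prodn_gt0 => l; exact: fact_gt0.
pose g : ncseries n.+1 := fun w => \sum_(P | setpart P) d P * eNC P w.
have gE w : g w = \sum_(p <- s) (type_fact p)%:R^-1 * eNC (type_part n p) w.
  rewrite /g /d; under eq_bigr => P _ do rewrite big_distrl /=.
  rewrite exchange_big /=; apply: eq_bigr => p _.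
  rewrite (bigD1 (type_part n p)) ?label_part_setpart //= eqxx mulr1.
  by rewrite big1 ?addr0 // => P /andP[_ /negbTE->]; rewrite mulr0 mul0r.
have eNC_ext P (w w' : 'I_n.+1 -> nat) : w =1 w' -> eNC P w = eNC P w'.
  move=> ww'; rewrite /eNC; congr (nat_of_bool _)%:R.
  apply: eq_forallb_in => B _; apply: eq_forallb_in => i _.
  by apply: eq_forallb_in => j _; rewrite !ww'.
apply: (@semi_sym_e_positive_avg _ _ d); first exact: in_espan_YG.
  by move=> P; apply: sumr_ge0 => p _; rewrite mulr_ge0 ?invr_ge0 ?ler0n.
apply: (@sum_perm_fix_last_eq _ (YG (tl_adj n.+1)) g) => [w w' ww'|w w' ww'|q m x k].
- rewrite /YG /proper_word; congr (nat_of_bool _)%:R.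
  by apply: eq_forallb => i; apply: eq_forallb => j; rewrite !ww'.
- by apply: eq_bigr => P _; rewrite (eNC_ext _ _ _ ww').
rewrite rooted_gf_YG sE /rooted_gf.
under [RHS]eq_bigr => w _ do rewrite gE scaler_suml.
rewrite exchange_big big_seq [RHS]big_seq /=; apply: eq_bigr => p ps.
under eq_bigr => w _ do rewrite -scalerA.
rewrite -scaler_sumr -/(rooted_gf x (eNC (type_part n p)) k).
rewrite rooted_gf_type_part ?(allP sP) // mulr_natl -scaler_nat scalerA.
by rewrite mulVf // scale1r.
Qed.

Theorem mainTheorem11 (n : nat) :
  (0 < n)%N ->
  semi_sym_e_positive (YG (tl_adj n)) /\ e_positive n (XG (tl_adj n)).
Proof.
case: n => // n _; split; first exact: YG_semi_sym_e_positive.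
exact: XG_e_positive.
Qed.
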